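(* Let $N,n$ be positive integers with $N\ge n+1$. Among all rooted trees with $N$ vertices and $n$ leaves, the rooted broom $B_{N-n-1,n}$ maximises the ancestral spectral radius $\rho_C$, and $$\rho_C(B_{N-n-1,n})=n(N-n-1)+1.$$
   Context: A rooted tree $T$ has a distinguished vertex $r$, the root; the level $\ell(v)$ of a vertex $v$ is its distance from $r$. A leaf is a vertex without children (the root counts as a leaf only if it is the only vertex). For vertices $v,w$, $v\vee w$ denotes the common ancestor of $v$ and $w$ farthest from the root (every vertex is an ancestor of itself). If $v_1,\ldots,v_n$ are the leaves, the ancestral matrix $C(T)$ is the $n\times n$ matrix with $(i,j)$ entry $\ell(v_i\vee v_j)$, and the ancestral spectral radius $\rho_C(T)$ is its largest eigenvalue. For integers $m\ge 0$, $n\ge 1$, the rooted broom $B_{m,n}$ is the rooted tree obtained from a path of length $m$, one end of which is the root, by attaching $n$ leaves to the other end; it has $n$ leaves and $m+n+1$ vertices. *)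

(* Defs.v *)
From HB Require Import structures.
From mathcomp Require Import all_boot all_order all_algebra.
From mathcomp Require Import classical_sets boolp reals.
From mathcomp Require complex polyrcf.

Set Implicit Arguments.
Unset Strict Implicit.
Unset Printing Implicit Defensive.

Import Order.TTheory GRing.Theory Num.Theory.

(* A [ucycle] of size 2 traverses a single edge back and forth, so the cycles
   of a simple graph are the [ucycle]s of size at least 3. *)
Record rooted_tree := RootedTree {
  vertex :> finType;
  adj : rel vertex;
  root : vertex;
  adj_sym : symmetric adj;
  adj_irr : irreflexive adj;
  adj_connected : forall v w : vertex, connect adj v w;
  adj_acyclic : forall c : seq vertex, ucycle adj c -> size c <= 2
}.

Section RootedTree.

Variable T : rooted_tree.
Implicit Types u v w : T.

Definition is_walk_length v w (k : nat) : bool :=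
  [exists p : k.-tuple T, path (@adj T) v p && (last v p == w)].

Lemma walk_length_exists v w : exists k, is_walk_length v w k.
Proof.
have /connectP[p vp ->] := adj_connected v w.
exists (size p); apply/existsP; exists (in_tuple p).
by rewrite /= vp eqxx.
Qed.

Definition dist v w : nat := ex_minn (walk_length_exists v w).

Definition level v : nat := dist (root T) v.

(* [u] lies on the simple path from the root to [v]. *)
Definition ancestor u v : bool :=
  `[< exists p : seq T,
      [/\ path (@adj T) (root T) p, uniq (root T :: p),
          last (root T) p = v & u \in root T :: p] >].

Definition child u v : bool := adj u v && (level v == (level u).+1).

Definition leaves : {set T} := [set v | ~~ [exists w, child v w]].

Definition join v w : T :=
  [arg max_(u > root T | ancestor u v && ancestor u w) level u].

(* The root is always a common ancestor, so the [arg max] above is never the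
   default value. *)
Lemma ancestor_root v : ancestor (root T) v.
Proof.
apply/asboolP; have /connectP[p pP ->] := adj_connected (root T) v.
case/shortenP: pP => q qP uq _.
by exists q; split; rewrite ?mem_head.
Qed.

Lemma leaves_gt0 : 0 < #|leaves|.
Proof.
case: (@arg_maxnP T (root T) xpredT level isT) => // v _ vmax.
apply/card_gt0P; exists v; rewrite inE; apply/existsPn => w.
by apply/negP => /andP[_ /eqP lw]; have := vmax w isT; rewrite /= lw ltnn.
Qed.

Lemma joinC v w : join v w = join w v.
Proof.
suff e : (fun u => ancestor u v && ancestor u w) =1
          (fun u => ancestor u w && ancestor u v).
  rewrite /join /arg_max /extremum; congr odflt; apply: eq_pick => u /=.
  rewrite e; congr (_ && _); apply: eq_forallb => x; by rewrite e.
by move=> u; rewrite andbC.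
Qed.

End RootedTree.

Local Open Scope ring_scope.

Definition ancestral_matrix (R : realType) (T : rooted_tree) :
    'M[R]_#|leaves T| :=
  \matrix_(i, j) (level (join (enum_val i) (enum_val j)))%:R.

Definition is_largest_eigenvalue (R : realType) n (A : 'M[R]_n) (a : R) : Prop :=
  eigenvalue A a /\ (forall b : R, eigenvalue A b -> b <= a).

(* The default value 0 is never used, see [ancestral_spectral_radiusP]. *)
Definition ancestral_spectral_radius (R : realType) (T : rooted_tree) : R :=
  xget 0 (is_largest_eigenvalue (ancestral_matrix R T)).

Section LargestEigenvalue.
Import complex.
Local Open Scope complex_scope.

Lemma symmetric_eigenvalue_exists (R : realType) n (A : 'M[R]_n) :
  (0 < n)%N -> A^T = A -> exists a, eigenvalue A a.
Proof.
move=> n0 symA; pose AC : 'M[R[i]]_n := map_mx (real_complex R) A.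
have [a aA] := eigenvalue_closed AC n0.
suff [b ab] : exists b, a = b%:C.
  by exists b; have := aA; rewrite ab eigenvalue_map.
have /eigenvalueP[v vA v0] := aA.
pose s := (v *m (map_mx conjc v)^T) 0 0.
have s0 : s != 0.
  rewrite /s !mxE; have /rV0Pn[i vi] := v0.
  rewrite psumr_neq0 => [|j _]; last by rewrite !mxE mul_conjC_ge0.
  by apply/hasP; exists i; rewrite ?mem_index_enum //= !mxE mul_conjC_gt0.
have AE : map_mx conjc AC = AC.
  by apply/matrixP => i j; rewrite !mxE conjc_real.
have ATE : AC^T = AC by rewrite /AC map_trmx symA.
have e1 : (v *m AC *m (map_mx conjc v)^T) 0 0 = a * s.
  by rewrite vA -scalemxAl mxE.
have e2 : (v *m AC *m (map_mx conjc v)^T) 0 0 = conjc a * s.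
  rewrite -mulmxA -{1}ATE -trmx_mul -{1}AE -map_mxM vA map_mxZ.
  by rewrite linearZ /= -scalemxAr mxE.
have := mulIf s0 (etrans (esym e1) e2).
case: a {aA vA e1 e2} => x y /= [] /eqP.
rewrite -addr_eq0 -mulr2n mulrn_eq0 /= => /eqP ->.
by exists x.
Qed.

Lemma largest_eigenvalue_exists (R : realType) n (A : 'M[R]_n) :
  (0 < n)%N -> A^T = A -> exists a, is_largest_eigenvalue A a.
Proof.
move=> n0 symA; have [a aA] := symmetric_eigenvalue_exists n0 symA.
have p0 : char_poly A != 0 by rewrite monic_neq0 // char_poly_monic.
pose s := polyrcf.rootsR (char_poly A).
have sP x : (x \in s) = eigenvalue A x.
  by rewrite -(polyrcf.roots_on_rootsR p0) in_itv /= eigenvalue_root_char.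
have /seq_tnthP[i0 _] : a \in s by rewrite sP.
case: (@arg_maxP _ _ _ i0 xpredT (tnth (in_tuple s))) => // i _ imax.
exists (tnth (in_tuple s) i); split; first by rewrite -sP mem_tnth.
by move=> b; rewrite -sP => /seq_tnthP[j ->]; exact: imax.
Qed.

Lemma ancestral_spectral_radiusP (R : realType) (T : rooted_tree) :
  is_largest_eigenvalue (ancestral_matrix R T) (ancestral_spectral_radius R T).
Proof.
apply: xgetPex; apply: largest_eigenvalue_exists; first exact: leaves_gt0.
by apply/matrixP => i j; rewrite !mxE joinC.
Qed.

End LargestEigenvalue.

Local Close Scope ring_scope.

Section Broom.

Variables m n : nat.
Let V : finType := 'I_(m + n).+1.

(* The path is 0 - 1 - ... - m, rooted at 0, and the vertices m+1, ..., m+n are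
   attached to m. *)
Definition broom_edge : rel V := fun i j =>
  ((i.+1 == j) && (j <= m)) || ((i == m :> nat) && (m < j)).

Definition broom_adj : rel V := fun i j => broom_edge i j || broom_edge j i.

Lemma broom_edge_lt i j : broom_edge i j -> i < j.
Proof. by case/orP => [/andP[/eqP<-]|/andP[/eqP->]]. Qed.

Lemma broom_edge_inj i j k : broom_edge i k -> broom_edge j k -> i = j.
Proof.
case/orP => /andP[/eqP ik mk]; case/orP => /andP[/eqP jk mk']; apply: val_inj.
- by apply: succn_inj; rewrite ik jk.
- by rewrite leqNgt mk' in mk.
- by rewrite leqNgt mk in mk'.
- by rewrite /= ik jk.
Qed.

Lemma broom_adj_sym : symmetric broom_adj.
Proof. by move=> i j; rewrite /broom_adj orbC. Qed.

Lemma broom_adj_irr : irreflexive broom_adj.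
Proof.
move=> i; rewrite /broom_adj orbb; apply/negP => /broom_edge_lt.
by rewrite ltnn.
Qed.

Lemma broom_connected i j : connect broom_adj i j.
Proof.
suff c0 k : connect broom_adj ord0 k.
  have cs := connect_sym (broom_adj : rel V).
  by apply: connect_trans (c0 j); rewrite (sym_connect_sym broom_adj_sym).
have [k' kE] : exists k', val k = k' by exists (val k).
elim/ltn_ind: k' k kE => k' IH k kE.
have [k0|k0] := posnP k'.
  suff -> : k = ord0 by exact: connect0.
  by apply: val_inj; rewrite kE k0.
pose l := minn k'.-1 m.
have lk : l < k' by rewrite /l gtn_min prednK ?leqnn.
have lV : l < (m + n).+1.
  by apply: ltn_trans lk _; rewrite -kE; exact: ltn_ord.
apply: connect_trans (IH l lk (Ordinal lV) erefl) _.
apply: connect1; rewrite /broom_adj /broom_edge /= kE.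
have [km|mk] := leqP k' m.
  have -> : l = k'.-1 by apply/minn_idPl; apply: leq_trans (leq_pred _) km.
  by rewrite prednK ?eqxx.
have -> : l = m by apply/minn_idPr; rewrite -ltnS prednK.
by rewrite eqxx orbT.
Qed.

Lemma broom_acyclic (c : seq V) : ucycle broom_adj c -> size c <= 2.
Proof.
case/andP=> cc uc; rewrite leqNgt; apply/negP => c3.
have [x0 x0c] : exists x, x \in c.
  by case: c c3 {cc uc} => // x c _; exists x; rewrite mem_head.
case: (@arg_maxnP V x0 (mem c) val x0c) => x xc xmax.
have [i s cE] := rot_to xc.
have : cycle broom_adj (x :: s) by rewrite -cE rot_cycle.
have : uniq (x :: s) by rewrite -cE rot_uniq.
have : 2 < size (x :: s) by rewrite -cE size_rot.
have smax y : y \in s -> y <= x.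
  move=> ys; apply: xmax; change (y \in c).
  by rewrite -(mem_rot i) cE inE ys orbT.
case: s smax {cE} => [|y s] smax //; case: (lastP s) smax => [|s' z] smax // _.
rewrite /= rcons_path last_rcons => /and3P[_ ys _] /and3P[xy _ zx].
have edge_x w : w \in y :: rcons s' z -> broom_adj w x -> broom_edge w x.
  move=> ws /orP[//|/broom_edge_lt xw].
  by have := smax w ws; rewrite leqNgt xw.
have yx : broom_edge y x by apply: edge_x; rewrite ?mem_head // broom_adj_sym.
have zxe : broom_edge z x.
  by apply: edge_x => //; rewrite inE mem_rcons mem_head orbT.
by move: ys; rewrite (broom_edge_inj yx zxe) mem_rcons mem_head.
Qed.

Definition broom : rooted_tree :=
  @RootedTree V broom_adj ord0 broom_adj_sym broom_adj_irr broom_connected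
    broom_acyclic.

End Broom.

(* Main.v *)
(** Every entry of the ancestral matrix is nonnegative, so its largest
    eigenvalue is at most its largest column sum.  The proper ancestors of a
    vertex are non-leaves, at pairwise distinct levels, and there are [N - n]
    non-leaves.  Hence a leaf has level at most [N - n], and the join of two
    distinct leaves, being a non-leaf itself, has level at most [N - n - 1];
    every column sum is therefore at most [(n - 1)(N - n - 1) + (N - n)].  In the
    broom all these inequalities are equalities, so the constant vector is an
    eigenvector for that value. *)

Require Import Defs.
From mathcomp Require Import all_boot all_order all_algebra.
From mathcomp Require Import reals.
Local Open Scope ring_scope.

Set Implicit Arguments.
Unset Strict Implicit.
Unset Printing Implicit Defensive.

Import Order.TTheory GRing.Theory Num.Theory.

Local Open Scope nat_scope.

(** * Levels, ancestors and joins in a rooted tree *)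

Section Tree.

Variable T : rooted_tree.
Implicit Types (u v w x : T) (p q : seq T).
Local Notation r := (Defs.root T).

Lemma shortest_path v :
  exists p, [/\ path (@adj T) r p, last r p = v & size p = level v].
Proof.
rewrite /level /dist; case: ex_minnP => k /existsP[p /andP[pP /eqP pv]] _.
by exists p; rewrite size_tuple.
Qed.

Lemma level_last_path p : path (@adj T) r p -> level (last r p) <= size p.
Proof.
move=> pP; rewrite /level /dist; case: ex_minnP => k _; apply.
by apply/existsP; exists (in_tuple p); rewrite /= pP eqxx.
Qed.

Lemma level_root : level r = 0.
Proof. by apply/eqP; rewrite -leqn0; exact: (@level_last_path [::]). Qed.

Lemma level_adj u v : adj u v -> level v <= (level u).+1.
Proof.
have [p [pP pu <-]] := shortest_path u => uv.
have := @level_last_path (rcons p v); rewrite rcons_path last_rcons size_rcons.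
by apply; rewrite pP pu.
Qed.

Lemma level_parent v : 0 < level v -> exists u, child u v.
Proof.
have [p [pP pv pl]] := shortest_path v.
case: (lastP p) pP pv pl => [|q x]; first by move=> _ _ <-.
rewrite rcons_path last_rcons size_rcons => /andP[qP ux] xv ql _.
exists (last r q); rewrite /child -xv ux /= eqn_leq level_adj //= xv -ql ltnS.
exact: level_last_path.
Qed.

Lemma child_notin_leaves u v : child u v -> u \notin leaves T.
Proof. by move=> uv; rewrite inE negbK; apply/existsP; exists v. Qed.

(** Climbing from [v] to a parent lowers the level by exactly one, so every smaller level is met,
    always at a vertex that has a child. *)
Lemma exists_level v k : k < level v ->
  exists2 u, u \notin leaves T & level u = k.
Proof.
have [m] := ubnP (level v); elim: m v => // m IH v vm kv.
have [|u uv] := @level_parent v; first exact: leq_ltn_trans kv.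
have /andP[_ /eqP lv] := uv; rewrite lv ltnS leq_eqVlt in kv.
case/orP: kv => [/eqP ->|ku]; last by apply: IH ku; rewrite lv ltnS in vm.
by exists u => //; exact: child_notin_leaves uv.
Qed.

Lemma level_le_nonleaves v : level v <= #|~: leaves T|.
Proof.
rewrite -[level v](size_iota 0) cardE -(size_map (@level T)).
apply: uniq_leq_size; first exact: iota_uniq.
move=> k; rewrite mem_iota add0n => /= kv.
have [u uL <-] := exists_level kv.
by apply: map_f; rewrite mem_enum inE.
Qed.

Lemma level_nonleaf_lt v : v \notin leaves T -> level v < #|~: leaves T|.
Proof.
rewrite inE negbK => /existsP[w /andP[_ /eqP <-]]; exact: level_le_nonleaves.
Qed.

(* Two simple paths with distinct first steps [y] and [z] from [x] connect [y]
   to [z] outside [x], which closes up to a cycle through [x]. *)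
Lemma simple_path_unique x p q :
  path (@adj T) x p -> path (@adj T) x q -> uniq (x :: p) -> uniq (x :: q) ->
  last x p = last x q -> p = q.
Proof.
elim: p x q => [|y p IH] x [|z q] //.
- by move=> _ _ _ /andP[+ _] /= xE; rewrite [in x \notin _]xE mem_last.
- by move=> _ _ /andP[+ _] _ /= xE; rewrite -[in x \notin _]xE mem_last.
case/andP=> xy yp /andP[xz zq] /andP[xyp yp_uniq] /andP[xzq zq_uniq] /= pq.
have [yz|yz] := eqVneq y z.
  by subst z; congr cons; apply: IH yp zq yp_uniq zq_uniq pq.
pose e := [rel u v | adj u v && ((u != x) && (v != x)) : bool] : rel T.
have e_sym : symmetric e.
  by move=> u v; rewrite /e /= adj_sym [(u != x) && _]andbC.
have to_last w s : path (@adj T) w s -> x \notin w :: s -> connect e w (last w s).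
  move=> ws xws; apply/connectP; exists s => //.
  apply: (@sub_in_path _ (predC1 x) (@adj T)) ws => [u v ux vx uv|].
    by move: ux vx; rewrite /e !inE /= uv => -> ->.
  by apply/allP => u uws; apply: contraNneq xws => <-.
have /connectP[s0 s0P zE] : connect e y z.
  apply: connect_trans (to_last _ _ yp xyp) _.
  by rewrite (sym_connect_sym e_sym) pq; apply: to_last.
case: (shortenP s0P) zE => s sP s_uniq _ zE.
have xs : x \notin y :: s.
  rewrite inE negb_or eq_sym; apply/andP; split.
    by apply: contraNneq xyp => ->; rewrite mem_head.
  elim: (s) (y) sP {s_uniq zE} => //= w t IHt u /andP[/and3P[_ _ wx] wt].
  by rewrite inE negb_or eq_sym wx; exact: IHt wt.
have := @adj_acyclic T [:: x, y & s]; rewrite /ucycle.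
have -> : cycle (@adj T) [:: x, y & s].
  rewrite /= xy rcons_path -zE adj_sym xz andbT.
  by apply: sub_path sP => u v /andP[].
(* An empty [s] would give [y = z]; otherwise the cycle has at least three vertices, which
   [adj_acyclic] forbids. *)
rewrite cons_uniq xs s_uniq; case: s zE {sP s_uniq xs} => [|? ?] zE.
  by rewrite zE eqxx in yz.
by move=> /(_ isT).
Qed.

(** A shortest walk shortens to a simple path, which by uniqueness is [p] itself. *)
Lemma level_last_simple p :
  path (@adj T) r p -> uniq (r :: p) -> level (last r p) = size p.
Proof.
move=> pP p_uniq; apply/eqP; rewrite eqn_leq level_last_path //=.
have [q0 [q0P + <-]] := shortest_path (last r p).
case: (shortenP q0P) => q qP q_uniq q_q0 qE.
rewrite (simple_path_unique pP qP) //.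
by apply: uniq_leq_size => //; have /andP[] := q_uniq.
Qed.

(** Prefixes of a simple path from the root are simple, so levels increase by one along it, and the
    vertex following [u] is a child of [u]. *)
Lemma ancestor_notin_leaves u v :
  ancestor u v -> u != v -> u \notin leaves T.
Proof.
case/boolp.asboolP=> p [pP p_uniq <-] up.
case/splitPl: up pP p_uniq => p1 [|x p2] uE.
  by rewrite cats0 uE eqxx.
rewrite -cat_rcons cat_path -cat_cons cat_uniq => /andP[p1x _] /and3P[p1x_uniq _ _] _.
apply: (@child_notin_leaves _ x); rewrite /child -uE.
have := p1x; rewrite rcons_path => /andP[p1P ->] /=.
have := level_last_simple p1x p1x_uniq; rewrite last_rcons size_rcons => ->.
rewrite level_last_simple //.
by move: p1x_uniq; rewrite -rcons_cons rcons_uniq => /andP[].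
Qed.

Lemma ancestor_refl v : ancestor v v.
Proof.
apply/boolp.asboolP; have /connectP[p pP ->] := adj_connected r v.
case/shortenP: pP => q qP q_uniq _.
by exists q; split; rewrite ?mem_last.
Qed.

Lemma child_ancestor u v : child u v -> ancestor u v.
Proof.
case/andP=> uv /eqP lv; apply/boolp.asboolP.
have [p0 [p0P + p0l]] := shortest_path u.
case: (shortenP p0P) => p pP p_uniq p_p0 pu.
have p_size : size p <= level u.
  by rewrite -p0l; apply: uniq_leq_size => //; have /andP[] := p_uniq.
exists (rcons p v); rewrite rcons_path last_rcons -rcons_cons rcons_uniq pP pu uv.
split=> //; last by rewrite -pu mem_rcons inE mem_last orbT.
rewrite p_uniq andbT; apply/negP => vp.
(* If [v] lay on the path to [u], the prefix ending at [v] would bound its level by that of [u]. *)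
case/splitPl: vp pP p_size {pu p_uniq p_p0} => p1 p2 vE.
rewrite cat_path => /andP[/level_last_path + _]; rewrite vE size_cat lv => l1 l2.
by have := leq_trans l1 (leq_trans (leq_addr (size p2) _) l2); rewrite ltnn.
Qed.

Lemma join_ancestor v w : ancestor (join v w) v && ancestor (join v w) w.
Proof. by rewrite /join; case: arg_maxnP => //; rewrite !ancestor_root. Qed.

Lemma level_join_max u v w :
  ancestor u v -> ancestor u w -> level u <= level (join v w).
Proof.
move=> uv uw; rewrite /join; case: arg_maxnP; first by rewrite !ancestor_root.
by move=> x _; apply; rewrite uv uw.
Qed.

(** The join differs from at least one of [v] and [w], hence is a proper ancestor of it. *)
Lemma join_notin_leaves v w : v != w -> join v w \notin leaves T.
Proof.
have /andP[jv jw] := join_ancestor v w.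
have [jv_eq vw|jNv _] := eqVneq (join v w) v; last exact: ancestor_notin_leaves jNv.
by rewrite jv_eq; apply: ancestor_notin_leaves vw; rewrite -{1}jv_eq.
Qed.

(** Descending [f] step by step yields a walk from the root of length [f v], and no walk is shorter,
    since [f] grows by at most one per edge. This gives the levels of the broom without analysing
    its paths. *)
Lemma level_unique (f : T -> nat) :
    f r = 0 -> (forall u v, adj u v -> f v <= (f u).+1) ->
    (forall v, v != r -> exists2 u, adj u v & f v = (f u).+1) ->
  forall v, level v = f v.
Proof.
move=> fr f_adj f_parent v; apply/eqP; rewrite eqn_leq; apply/andP; split.
  have [m] := ubnP (f v); elim: m v => // m IH v vm.
  have [->|/f_parent[u uv fv]] := eqVneq v r; first by rewrite level_root.
  apply: leq_trans (level_adj uv) _; rewrite fv ltnS.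
  by apply: IH; rewrite fv in vm.
have [p [pP <- <-]] := shortest_path v.
rewrite -[size p]add0n -fr; elim: p (r) pP => [|y p IH] x /=.
  by rewrite addn0.
case/andP=> xy yp; apply: leq_trans (IH y yp) _.
by rewrite addnS -addSn leq_add2r f_adj.
Qed.

End Tree.

(** * Levels, leaves and joins in the broom *)

Section Broom.

Variables m n : nat.
Local Notation B := (broom m n).
Implicit Types u v : 'I_(m + n).+1.

Lemma broom_level v : level (v : B) = minn v m.+1.
Proof.
pose f (v : B) := minn (v : 'I_(m + n).+1) m.+1.
have edgeE u w : broom_edge u w -> f w = (f u).+1.
  rewrite /f; case/orP => /andP[/eqP uw mw].
    have um : u < m by rewrite uw.
    by rewrite -uw (minn_idPl (leqW um)) (minn_idPl (leqW (ltnW um))).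
  by rewrite uw (minn_idPr mw) (minn_idPl (leqnSn m)).
apply: (@level_unique B f) => [|u w|{}v v0]; first by rewrite /f min0n.
  by case/orP => /edgeE ->; rewrite // ltnW // ltnW.
have v_gt0 : 0 < (v : 'I_(m + n).+1).
  by rewrite lt0n; apply: contraNneq v0 => v0; apply/eqP/val_inj.
(* The parent of [v] is [v.-1] on the path and [m] for an attached leaf; the minimum covers both
   cases. *)
have u_lt : minn v.-1 m < (m + n).+1.
  by rewrite ltnS geq_min leq_addr orbT.
have uv : broom_edge (Ordinal u_lt) v.
  rewrite /broom_edge /=; have [vm|mv] := leqP v m; last first.
    by rewrite (minn_idPr _) ?eqxx ?mv ?orbT // -ltnS prednK.
  by rewrite (minn_idPl (leq_trans (leq_pred _) vm)) prednK ?eqxx ?vm.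
by exists (Ordinal u_lt : B); [apply/orP; left | exact: edgeE].
Qed.

Lemma broom_leaves v : 0 < n -> ((v : B) \in leaves B) = (m < v).
Proof.
move=> n_gt0; rewrite inE; apply/idP/idP => [|mv].
  apply: contraR; rewrite -leqNgt => vm; apply/existsP.
  (* The child of [v] is the next path vertex, or the first attached leaf if [v] is [m]; the latter
     exists because [n] is positive. *)
  have w_lt : v.+1 < (m + n).+1.
    by rewrite ltnS -[(v : nat).+1]addn1 leq_add.
  exists (Ordinal w_lt : B); rewrite /child !broom_level /= !(minn_idPl _) //.
    rewrite eqxx andbT; apply/orP; left.
    rewrite /broom_edge /= eqxx /= ltnS.
    by have [->|vNm] := eqVneq (v : nat) m; rewrite ?leqnn ?orbT // ltn_neqAle vNm vm.
  by rewrite ltnW.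
apply/existsPn => w; rewrite /child !broom_level (minn_idPr mv).
by rewrite negb_and (ltn_eqF _) ?orbT // ltnS geq_minr.
Qed.

Lemma card_broom_leaves : 0 < n -> #|leaves B| = n.
Proof.
move=> n_gt0.
have inj : injective (fun i : 'I_n => rshift m.+1 i : B).
  by move=> i j ij; exact: (@rshift_inj m.+1 n).
rewrite -[RHS]card_ord -(card_imset _ inj); apply: eq_card => v.
rewrite broom_leaves //; apply/idP/imsetP => [mv|[i _ ->]]; last first.
  by rewrite /= leq_addr.
have i_lt : v - m.+1 < n by rewrite ltn_subLR // addSn.
by exists (Ordinal i_lt) => //; apply: val_inj; rewrite /= subnKC.
Qed.

Lemma broom_join_level u v :
  0 < n -> (u : B) \in leaves B -> (v : B) \in leaves B ->
  level (join (u : B) v) = m + (u == v).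
Proof.
move=> n_gt0 uL vL; have := uL; have := vL; rewrite !broom_leaves // => mv mu.
have [<-|uv] := eqVneq u v.
  apply/eqP; rewrite addn1 eqn_leq broom_level geq_minr /=.
  rewrite -(broom_level (join (u : B) u)).
  have := @level_join_max B u u u (ancestor_refl _) (ancestor_refl _).
  by rewrite [level (u : B)]broom_level (minn_idPr mu).
(* For distinct leaves the vertex [m] is a common ancestor at level [m], and the join, not being a
   leaf, lies on the path and so is no deeper. *)
have mB : m < (m + n).+1 by rewrite ltnS leq_addr.
have center_ancestor w : m < (w : 'I__) -> ancestor (Ordinal mB : B) w.
  move=> mw; apply: child_ancestor; rewrite /child !broom_level /=.
  rewrite (minn_idPr mw) (minn_idPl (leqnSn m)) eqxx andbT.
  by rewrite /broom_adj /broom_edge /= eqxx mw orbT.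
apply/eqP; rewrite addn0 eqn_leq; apply/andP; split.
  have := @join_notin_leaves B u v uv; rewrite broom_leaves // -leqNgt.
  by rewrite broom_level; apply: leq_trans (geq_minl _ _).
have := level_join_max (center_ancestor _ mu) (center_ancestor _ mv).
by rewrite [level (Ordinal mB : B)]broom_level /= (minn_idPl (leqnSn m)).
Qed.

End Broom.

(** * Bounds on the spectral radius *)

Local Open Scope ring_scope.

(** Compare both sides of [v *m A = a *: v] at a coordinate where [v] is largest in absolute value.
    Eigenvectors are rows here, hence column sums. *)
Lemma eigenvalue_le_col_sum (R : realFieldType) (n : nat) (A : 'M[R]_n) (a c : R) :
  (forall i j, 0 <= A i j) -> (forall j, \sum_i A i j <= c) ->
  eigenvalue A a -> a <= c.
Proof.
move=> A_ge0 A_le /eigenvalueP[v vA /rV0Pn[i0 vi0]].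
case: (@Order.TotalTheory.arg_maxP _ _ _ i0 xpredT (fun i => `|v 0 i|)) => // j _ jmax.
have vj_gt0 : 0 < `|v 0 j|.
  by apply: lt_le_trans (jmax i0 isT); rewrite normr_gt0.
apply: le_trans (ler_norm a) _; rewrite -(ler_pM2r vj_gt0) -normrM.
have -> : a * v 0 j = \sum_i v 0 i * A i j.
  by have /rowP/(_ j) := vA; rewrite !mxE.
apply: le_trans (ler_norm_sum _ _ _) _.
apply: le_trans (_ : \sum_i A i j * `|v 0 j| <= _).
  apply: ler_sum => i _; rewrite normrM mulrC (ger0_norm (A_ge0 i j)).
  by apply: ler_wpM2l => //; exact: jmax.
by rewrite -mulr_suml; apply: ler_wpM2r.
Qed.

(** This is a column sum of the matrix with [k.+1] on the diagonal and [k] elsewhere, which is the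
    ancestral matrix of a broom and bounds that of a general tree entrywise. *)
Lemma sum_delta_row (n k : nat) (j : 'I_n) :
  (\sum_(i < n) (k + (i == j)) = n * k + 1)%N.
Proof.
rewrite big_split /= sum_nat_const card_ord (bigD1 j) //= eqxx big1 ?addn0 //.
by move=> i /negbTE ->.
Qed.

Lemma ancestral_spectral_radius_le (R : realType) (T : rooted_tree) :
  (0 < #|~: leaves T|)%N ->
  ancestral_spectral_radius R T
    <= (#|leaves T| * #|~: leaves T|.-1 + 1)%N%:R.
Proof.
move=> L_gt0; have [+ _] := ancestral_spectral_radiusP R T.
apply: eigenvalue_le_col_sum => [i j|j]; first by rewrite mxE.
rewrite -(sum_delta_row _ j) natr_sum; apply: ler_sum => i _.
rewrite mxE ler_nat; have [_|ij] := eqVneq i j.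
  by rewrite addn1 prednK // level_le_nonleaves.
rewrite addn0 -ltnS prednK //; apply: level_nonleaf_lt.
by apply: join_notin_leaves; rewrite (inj_eq enum_val_inj).
Qed.

Lemma broom_spectral_radius_ge (R : realType) (m n : nat) : (0 < n)%N ->
  (n * m + 1)%N%:R <= ancestral_spectral_radius R (broom m n).
Proof.
move=> n_gt0; have [_] := ancestral_spectral_radiusP R (broom m n).
(* All column sums agree, so the all-ones row is an eigenvector. *)
apply; apply/eigenvalueP; exists (const_mx 1); last first.
  apply/rV0Pn; exists (Ordinal (leaves_gt0 (broom m n))).
  by rewrite mxE oner_neq0.
apply/rowP => j; rewrite !mxE mulr1.
have -> : (n * m + 1 = \sum_(i < #|leaves (broom m n)|) (m + (i == j)))%N.
  by rewrite sum_delta_row card_broom_leaves.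
rewrite natr_sum; apply: eq_bigr => i _.
by rewrite !mxE mul1r broom_join_level ?enum_valP // (inj_eq enum_val_inj).
Qed.

Theorem theorem2p10 (R : realType) (N n : nat)
    (N_gt0 : (0 < N)%N) (n_gt0 : (0 < n)%N) (hN : (n + 1 <= N)%N) :
  [/\ #|broom (N - n - 1) n| = N,
      #|leaves (broom (N - n - 1) n)| = n,
      (forall T : rooted_tree, #|T| = N -> #|leaves T| = n ->
         ancestral_spectral_radius R T
           <= ancestral_spectral_radius R (broom (N - n - 1) n)) &
      ancestral_spectral_radius R (broom (N - n - 1) n)
        = (n * (N - n - 1) + 1)%N%:R].
Proof.
have radius_le (T : rooted_tree) : #|T| = N -> #|leaves T| = n ->
    ancestral_spectral_radius R T <= (n * (N - n - 1) + 1)%N%:R.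
  move=> TN Tn; have nonleavesE : #|~: leaves T| = (N - n)%N.
    by rewrite cardsCs setCK TN Tn.
  have := @ancestral_spectral_radius_le R T.
  by rewrite nonleavesE Tn -subn1; apply; rewrite subn_gt0 -addn1.
have card_B : #|broom (N - n - 1) n| = N.
  by rewrite card_ord -addnS -subnDA addn1 subnK // -addn1.
have card_L := card_broom_leaves (N - n - 1) n_gt0.
have radius_ge := broom_spectral_radius_ge R (N - n - 1) n_gt0.
split=> // [T TN Tn|]; first exact: le_trans (radius_le T TN Tn) radius_ge.
(* The general upper bound, applied to the broom itself, meets its lower bound. *)
by apply/le_anti; rewrite radius_le.
Qed.
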